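(* Let $\mathbf{L}$ be a PBZ$^{\ast}$-lattice. Then $C_{pbz}(\mathbf{L})=C(\mathbf{L})$; that is, the PBZ$^{\ast}$-central elements of $\mathbf{L}$ are exactly the central elements of $\mathbf{L}$.
   Context: A bounded involution lattice is an algebra $(L,\wedge,\vee,{}^{\prime},0,1)$ such that $(L,\wedge,\vee,0,1)$ is a bounded lattice, $a^{\prime\prime}=a$, and $a\leq b$ implies $b^{\prime}\leq a^{\prime}$. It is a pseudo-Kleene algebra if $a\wedge a^{\prime}\leq b\vee b^{\prime}$ for all $a,b$. A BZ-lattice is an algebra $\mathbf{L}=(L,\wedge,\vee,{}^{\prime},{}^{\sim},0,1)$ whose reduct without ${}^{\sim}$ is a pseudo-Kleene algebra and such that for all $a,b\in L$: $a\wedge a^{\sim}=0$; $a\leq a^{\sim\sim}$; $a\leq b$ implies $b^{\sim}\leq a^{\sim}$; $a^{\sim\prime}=a^{\sim\sim}$. Write $\Diamond x=x^{\sim\sim}$ and $\square x=x^{\prime\sim}$. A PBZ$^{\ast}$-lattice is a BZ-lattice satisfying $(a\wedge a^{\prime})^{\sim}\leq a^{\sim}\vee\square a$ for all $a$, and which is paraorthomodular: $a\leq b$ and $a^{\prime}\wedge b=0$ imply $a=b$. An element $a\in L$ is PBZ$^{\ast}$-central if for all $b\in L$: $(a\wedge b)\vee(a^{\prime}\wedge b)=b$, $(a\wedge b)^{\sim}=a^{\sim}\vee b^{\sim}$, and $(a^{\prime}\wedge b)^{\sim}=\square a\vee b^{\sim}$. $C_{pbz}(\mathbf{L})$ denotes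 the set of PBZ$^{\ast}$-central elements of $\mathbf{L}$. An element $e\in L$ is central if the principal congruences $Cg(e,0)$ and $Cg(e,1)$ of $\mathbf{L}$ (in the full signature, generated by $(e,0)$ and by $(e,1)$ respectively) are complementary factor congruences, i.e. their intersection is the identity relation, they permute, and their join (composition) is $L\times L$. $C(\mathbf{L})$ denotes the set of central elements of $\mathbf{L}$. *)

(* Defs.v *)
From HB Require Import structures.
From mathcomp Require Import all_boot all_order.
From mathcomp Require Import mathcomp_extra boolp classical_sets.

Set Implicit Arguments.
Unset Strict Implicit.
Unset Printing Implicit Defensive.

Local Open Scope classical_set_scope.
Local Open Scope order_scope.

(* [kcompl a] is the involution a', [bcompl a] the Brouwer complement a^~.
   The choice structure and the boolean order that [tbLatticeType] requires
   are no restriction: classically every bounded lattice carries them.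
   Nothing forces \bot != \top, so the trivial algebra is included. *)

HB.mixin Record TBLattice_hasInvolution d T of Order.TBLattice d T := {
  kcompl : T -> T;
  kcomplK : forall a : T, kcompl (kcompl a) = a;
  kcompl_anti : forall a b : T, a <= b -> kcompl b <= kcompl a;
}.

#[short(type="involutionLatticeType")]
HB.structure Definition InvolutionLattice d :=
  { T of Order.TBLattice d T & TBLattice_hasInvolution d T }.

HB.mixin Record InvolutionLattice_isPseudoKleene d T
    of InvolutionLattice d T := {
  pseudo_kleene : forall a b : T, a `&` kcompl a <= b `|` kcompl b;
}.

#[short(type="pseudoKleeneType")]
HB.structure Definition PseudoKleene d :=
  { T of InvolutionLattice d T & InvolutionLattice_isPseudoKleene d T }.

HB.mixin Record PseudoKleene_isBZLattice d T of PseudoKleene d T := {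
  bcompl : T -> T;
  meet_bcompl : forall a : T, a `&` bcompl a = \bot;
  le_bcompl2 : forall a : T, a <= bcompl (bcompl a);
  bcompl_anti : forall a b : T, a <= b -> bcompl b <= bcompl a;
  kcompl_bcompl : forall a : T, kcompl (bcompl a) = bcompl (bcompl a);
}.

#[short(type="bzLatticeType")]
HB.structure Definition BZLattice d :=
  { T of PseudoKleene d T & PseudoKleene_isBZLattice d T }.

Notation box a := (bcompl (kcompl a)).

HB.mixin Record BZLattice_isPBZStar d T of BZLattice d T := {
  star_ax : forall a : T,
    bcompl (a `&` kcompl a) <= bcompl a `|` box a;
  paraorthomodular : forall a b : T,
    a <= b -> kcompl a `&` b = \bot -> a = b;
}.

#[short(type="pbzStarLatticeType")]
HB.structure Definition PBZStarLattice d :=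
  { T of BZLattice d T & BZLattice_isPBZStar d T }.

Definition pbz_center d (L : pbzStarLatticeType d) : set L :=
  [set a | forall b : L,
    [/\ (a `&` b) `|` (kcompl a `&` b) = b,
        bcompl (a `&` b) = bcompl a `|` bcompl b &
        bcompl (kcompl a `&` b) = box a `|` bcompl b]].
Arguments pbz_center {d} L.

(* Compatibility with the constants \bot and \top is automatic. *)
Record congruence d (L : bzLatticeType d) (R : set (L * L)) : Prop := {
  congr_refl : forall x, R (x, x);
  congr_sym : forall x y, R (x, y) -> R (y, x);
  congr_trans : forall x y z, R (x, y) -> R (y, z) -> R (x, z);
  congr_meet : forall x1 y1 x2 y2,
    R (x1, y1) -> R (x2, y2) -> R (x1 `&` x2, y1 `&` y2);
  congr_join : forall x1 y1 x2 y2,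
    R (x1, y1) -> R (x2, y2) -> R (x1 `|` x2, y1 `|` y2);
  congr_kcompl : forall x y, R (x, y) -> R (kcompl x, kcompl y);
  congr_bcompl : forall x y, R (x, y) -> R (bcompl x, bcompl y);
}.

Definition Cg d (L : bzLatticeType d) (a b : L) : set (L * L) :=
  smallest (@congruence d L) [set (a, b)].

(* Join in the lattice of congruences; it equals R \; S when R and S permute. *)
Definition congr_sup d (L : bzLatticeType d) (R S : set (L * L)) :
    set (L * L) :=
  smallest (@congruence d L) (R `|` S)%classic.

Definition complementary_factors d (L : bzLatticeType d)
    (R S : set (L * L)) : Prop :=
  [/\ congruence R, congruence S,
      (R `&` S)%classic = diagonal,
      (R \; S)%relation = (S \; R)%relation &
      congr_sup R S = setT].

Definition center d (L : bzLatticeType d) : set L :=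
  [set e | complementary_factors (Cg e \bot) (Cg e \top)].
Arguments center {d} L.

(* Main.v *)
Require Import Defs.
From mathcomp Require Import all_boot all_order.
From mathcomp Require Import mathcomp_extra boolp classical_sets.

(** If [a] is PBZ*-central, then so is [a'], and both [x `&` a = y `&` a] and
    [x `&` a' = y `&` a'] are congruences; they contain [Cg(a, 1)] and
    [Cg(a, 0)] respectively, and they meet in the identity since
    [x = (a `&` x) `|` (a' `&` x)].  Moreover [(a' `&` x) `|` (a `&` y)] is
    congruent to [x] modulo [Cg(a, 0)] and to [y] modulo [Cg(a, 1)], so the two
    congruences permute and compose to everything.  Conversely, each equation
    defining PBZ*-centrality of [e] holds modulo [Cg(e, 0)] and modulo
    [Cg(e, 1)], because it holds for [e := 0] and for [e := 1]. *)

Set Implicit Arguments.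
Unset Strict Implicit.
Unset Printing Implicit Defensive.

Import Order.TTheory.
Local Open Scope classical_set_scope.
Local Open Scope order_scope.

Section Involution.
Context (d : Order.disp_t) (L : involutionLatticeType d).
Implicit Types a b x y : L.

Lemma kcomplI x y : kcompl (x `&` y) = kcompl x `|` kcompl y.
Proof.
apply/le_anti/andP; split; last first.
  by rewrite leUx !kcompl_anti ?leIl ?leIr.
have kle z w : kcompl z <= w -> kcompl w <= z.
  by move=> /kcompl_anti; rewrite kcomplK.
apply: (kle); rewrite lexI.
by apply/andP; split; apply: kle; rewrite ?leUl ?leUr.
Qed.

Lemma kcomplU x y : kcompl (x `|` y) = kcompl x `&` kcompl y.
Proof. by rewrite -[RHS]kcomplK kcomplI !kcomplK. Qed.

Lemma kcompl0 : kcompl \bot = \top :> L.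
Proof.
by apply/le_anti; rewrite lex1 -[leLHS]kcomplK kcompl_anti ?le0x.
Qed.

Lemma kcompl1 : kcompl \top = \bot :> L.
Proof. by rewrite -kcompl0 kcomplK. Qed.

(** The first clause of PBZ*-centrality; on its own it already makes [_]&[a] distribute over
    joins. *)
Definition splitting a := forall b, (a `&` b) `|` (kcompl a `&` b) = b.

Lemma splittingC a : splitting a -> splitting (kcompl a).
Proof. by move=> sa b; rewrite kcomplK joinC sa. Qed.

Lemma splitting_dual a b :
  splitting a -> (a `|` b) `&` (kcompl a `|` b) = b.
Proof.
move=> /(_ (kcompl b)) /(congr1 kcompl).
by rewrite kcomplU !kcomplI !kcomplK meetC.
Qed.

Lemma splitting_meetC a : splitting a -> a `&` kcompl a = \bot.
Proof. by move=> /(splitting_dual \bot); rewrite !joinx0. Qed.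

(** Let [u] be the right-hand side. As [u <= a], the dual splitting of [u] reads
    [u = a]&[(kcompl a]|[u)], so it suffices that [x] and [y] lie below [kcompl a]|[u]; splitting
    each of them along [a] shows this. *)
Lemma splitting_meetUl a x y :
  splitting a -> (x `|` y) `&` a = (x `&` a) `|` (y `&` a).
Proof.
move=> sa; apply/le_anti/andP; split; last first.
  by rewrite leUx !lexI !leIr !andbT (le_trans (leIl _ _)) ?leUl //=
             (le_trans (leIl _ _)) ?leUr.
set u := (x `&` a) `|` (y `&` a).
have ua : a `|` u = a by apply/join_l; rewrite leUx !leIr.
have leu z : z `&` a <= u -> z <= kcompl a `|` u.
  move=> zu; rewrite -[z]sa leUx; apply/andP; split.
    by rewrite meetC (le_trans zu) ?leUr.
  by rewrite (le_trans (leIl _ _)) ?leUl.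
rewrite -[leRHS](splitting_dual u sa) ua lexI leIr /=.
by rewrite (le_trans (leIl _ _)) // leUx !leu ?leUl ?leUr.
Qed.

(** Shows that [kcompl x]&[a] depends only on [x]&[a], as compatibility of the relation in
    [meet_congruence] with the involution requires. *)
Lemma splitting_meet_kcompl a x :
  splitting a -> kcompl x `&` a = kcompl (x `&` a) `&` a.
Proof.
move=> sa; rewrite kcomplI splitting_meetUl // [kcompl a `&` a]meetC.
by rewrite splitting_meetC // joinx0.
Qed.

End Involution.

Section BZ.
Context (d : Order.disp_t) (L : bzLatticeType d).
Implicit Types a b x y : L.

Lemma bcompl1 : bcompl \top = \bot :> L.
Proof. by rewrite -[LHS]meet1x meet_bcompl. Qed.

Lemma bcompl0 : bcompl \bot = \top :> L.
Proof. by apply/le_anti; rewrite lex1 -bcompl1 le_bcompl2. Qed.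

Lemma Cg_congruence a b : congruence (Cg a b).
Proof.
split=> [x|x y xy|x y z xy yz|x1 y1 x2 y2 xy1 xy2|x1 y1 x2 y2 xy1 xy2
  |x y xy|x y xy] R [cR sR].
- exact: congr_refl.
- by apply: congr_sym; last exact: xy.
- by apply: congr_trans; [|exact: xy|exact: yz].
- by apply: congr_meet; [|exact: xy1|exact: xy2].
- by apply: congr_join; [|exact: xy1|exact: xy2].
- by apply: congr_kcompl; last exact: xy.
- by apply: congr_bcompl; last exact: xy.
Qed.

Lemma Cg_gen a b : Cg a b (a, b).
Proof. by move=> R [_]; apply. Qed.

Lemma Cg_min a b (R : set (L * L)) :
  congruence R -> R (a, b) -> Cg a b `<=` R.
Proof. by move=> cR Rab; apply: smallest_sub => // _ ->. Qed.

Lemma meet_congruence a :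
  splitting a -> (forall b, bcompl (a `&` b) = bcompl a `|` bcompl b) ->
  congruence [set xy : L * L | xy.1 `&` a = xy.2 `&` a].
Proof.
move=> sa ba.
(* Expanding [bcompl (x]&[a)] adds only the joinand [bcompl a], which meets [a] in [\bot]. *)
have bcomplE x : bcompl x `&` a = bcompl (x `&` a) `&` a.
  by rewrite [x `&` a]meetC ba splitting_meetUl // [bcompl a `&` a]meetC
             meet_bcompl join0x.
split=> [//|x y //|x y z /= -> //|x1 y1 x2 y2 /= xy1 xy2
  |x1 y1 x2 y2 /= xy1 xy2|x y /= xy|x y /= xy].
- by rewrite -[LHS]meetA xy2 [LHS]meetCA [RHS]meetAC xy1 meetC.
- by rewrite !splitting_meetUl // xy1 xy2.
- by rewrite splitting_meet_kcompl // xy -splitting_meet_kcompl.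
- by rewrite bcomplE xy -bcomplE.
Qed.

(** By symmetry, if [R \; S] is total then so is [S \; R]; hence the two permute, and by
    transitivity any congruence containing both is total. *)
Lemma complementary_factors_full (R S : set (L * L)) :
  congruence R -> congruence S -> (R `&` S)%classic `<=` diagonal ->
  (forall x y, exists2 z, R (x, z) & S (z, y)) -> complementary_factors R S.
Proof.
move=> cR cS RS0 RS; split=> //.
- apply/seteqP; split=> // -[x y]; rewrite /diagonal /= => ->.
  by split; exact: congr_refl.
- apply/seteqP; split=> -[x y] _ /=.
    by have [z xz zy] := RS x y; exists z.
  have [z yz zx] := RS y x.
  by exists z; [exact: congr_sym zx|exact: congr_sym yz].
- apply/seteqP; split=> // -[x y] _ M [cM sM].
  have [z xz zy] := RS x y.
  by apply: (congr_trans cM (y := z)); apply: sM; [left|right].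
Qed.

(** Modulo [R], [a] becomes [\bot] and [kcompl a] becomes [\top], so [bcompl a] becomes [\top] and
    [box a] becomes [\bot]. *)
Lemma congr_l0 (R : set (L * L)) a b : congruence R -> R (a, \bot) ->
  [/\ R ((a `&` b) `|` (kcompl a `&` b), b),
      R (bcompl (a `&` b), bcompl a `|` bcompl b) &
      R (bcompl (kcompl a `&` b), box a `|` bcompl b)].
Proof.
move=> cR Ra.
have Rb := congr_refl cR b; have Rb' := congr_bcompl cR Rb.
have Ra' := congr_kcompl cR Ra; have Rab := congr_meet cR Ra Rb.
have Rab' := congr_meet cR Ra' Rb.
split.
- by have := congr_join cR Rab Rab'; rewrite kcompl0 meet0x meet1x join0x.
- apply: (congr_trans cR (congr_bcompl cR Rab)); apply: congr_sym => //.
  have := congr_join cR (congr_bcompl cR Ra) Rb'.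
  by rewrite meet0x bcompl0 join1x.
- apply: (congr_trans cR (congr_bcompl cR Rab')); apply: congr_sym => //.
  have := congr_join cR (congr_bcompl cR Ra') Rb'.
  by rewrite kcompl0 meet1x bcompl1 join0x.
Qed.

(** Replacing [a] by [kcompl a] swaps the last two clauses and preserves the first, so the previous
    lemma applies to [kcompl a]. *)
Lemma congr_l1 (R : set (L * L)) a b : congruence R -> R (a, \top) ->
  [/\ R ((a `&` b) `|` (kcompl a `&` b), b),
      R (bcompl (a `&` b), bcompl a `|` bcompl b) &
      R (bcompl (kcompl a `&` b), box a `|` bcompl b)].
Proof.
move=> cR /(congr_kcompl cR); rewrite kcompl1 => /(congr_l0 b cR) [].
by rewrite kcomplK joinC.
Qed.

End BZ.

Arguments Cg_gen {d L} a b.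

Section Center.
Context (d : Order.disp_t) (L : pbzStarLatticeType d).

Lemma pbz_center_sub_center : pbz_center L `<=` center L.
Proof.
move=> a aP.
have sa : splitting a by move=> b; have [] := aP b.
have sa' := splittingC sa.
(* The second clause of centrality handles [a], the third [kcompl a]. *)
have cS : congruence [set xy : L * L | xy.1 `&` a = xy.2 `&` a].
  by apply: meet_congruence => // b; have [] := aP b.
have cR :
    congruence [set xy : L * L | xy.1 `&` kcompl a = xy.2 `&` kcompl a].
  by apply: meet_congruence => // b; have [] := aP b.
have c0 := Cg_congruence a \bot; have c1 := Cg_congruence a \top.
apply: complementary_factors_full => //.
  move=> [x y] [xy0 xy1].
  have /= xa' : x `&` kcompl a = y `&` kcompl a.
    by apply: (Cg_min cR _ xy0); rewrite /= meet0x splitting_meetC.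
  have /= xa : x `&` a = y `&` a.
    by apply: (Cg_min cS _ xy1); rewrite /= meet1x meetxx.
  rewrite /diagonal /= -[LHS]sa -[RHS]sa.
  by rewrite ![_ `&` x]meetC ![_ `&` y]meetC xa xa'.
(* The witness takes its part below [a] from [y] and its part below [kcompl a] from [x]; [Cg a \bot]
   collapses the former parts to [\bot], [Cg a \top] the latter. *)
move=> x y; exists ((a `&` y) `|` (kcompl a `&` x)).
- rewrite -{1}[x]sa; apply: (congr_join c0); last exact: (congr_refl c0).
  have H z : Cg a \bot (a `&` z, \bot).
    have := congr_meet c0 (Cg_gen a \bot) (congr_refl c0 z).
    by rewrite meet0x.
  exact: (congr_trans c0 (H x) (congr_sym c0 (H y))).
- rewrite -{2}[y]sa; apply: (congr_join c1); first exact: (congr_refl c1).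
  have H z : Cg a \top (kcompl a `&` z, \bot).
    have := congr_kcompl c1 (Cg_gen a \top).
    by move=> /(congr_meet c1) /(_ (congr_refl c1 z)); rewrite kcompl1 meet0x.
  exact: (congr_trans c1 (H x) (congr_sym c1 (H y))).
Qed.

Lemma center_sub_pbz_center : center L `<=` pbz_center L.
Proof.
move=> e [c0 c1 c01 _ _] b.
(* Since the two congruences meet in the identity, an equation may be checked modulo each of
   them. *)
have eqP x y : Cg e \bot (x, y) -> Cg e \top (x, y) -> x = y.
  move=> xy0 xy1; have : (Cg e \bot `&` Cg e \top)%classic (x, y) by [].
  by rewrite c01.
have [p0 q0 r0] := congr_l0 b c0 (Cg_gen e \bot).
have [p1 q1 r1] := congr_l1 b c1 (Cg_gen e \top).
by split; apply: eqP.
Qed.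

End Center.

Theorem theorem34 (d : Order.disp_t) (L : pbzStarLatticeType d) :
  pbz_center L = center L.
Proof.
apply/seteqP; split; [exact: pbz_center_sub_center|].
exact: center_sub_pbz_center.
Qed.
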